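(* Let $\epsilon=\pm1$, $h\ge 0$, and let $(G,D)$ be a finite $3$-transposition group of type $3^{\bullet h}\,{}^{+}\Omega_m^{\epsilon}(3)$. (a) If $m\ge 5$ is odd, then the diagram of $(G,D)$ has size $n=3^h(3^{m-1}-\epsilon3^{(m-1)/2})/2$ and spectrum $$((\,3^{m-2+h}-2\epsilon3^{(m-3)/2+h}-1;\ [3^{(m-3)/2+h}-1]^{f},\ [-1]^{\star},\ [-3^{(m-3)/2+h}-1]^{g}\,)),$$ where $f=(3^{m-1}-1-(\epsilon-1)(3^{(m-1)/2}-1))/4$ and $g=(3^{m-1}-1-(\epsilon+1)(3^{(m-1)/2}+1))/4$. (b) If $m\ge 6$ is even, then the diagram of $(G,D)$ has size $n=3^h(3^{m-1}-\epsilon3^{(m-2)/2})/2$ and spectrum $$((\,3^{m-2+h}-1;\ [-\epsilon3^{(m-2)/2+h}-1]^{d},\ [-1]^{\star},\ [\epsilon3^{(m-4)/2+h}-1]^{e}\,)),$$ where $d=(3^{m/2}-\epsilon)(3^{(m-2)/2}-\epsilon)/8$ and $e=(3^m-9)/8$.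
   Context: A $3$-transposition group $(G,D)$ is a group $G$ generated by a conjugacy class $D$ of elements of order $2$ such that the product of any two elements of $D$ has order $1$, $2$ or $3$. Its diagram is the graph with vertex set $D$ in which two elements are adjacent iff their product has order $3$; its size is $n=|D|$. The spectrum is that of the $(0,1)$-adjacency matrix, written $((k;\dots,[r]^c,\dots))$: first the degree $k$ of the (regular) diagram, counted once, then the remaining eigenvalues, $[r]^c$ meaning $r$ with multiplicity $c$; if listed values coincide, their multiplicities are added, and $[r]^\star$ means that $r$ has whatever further multiplicity (possibly zero) is required for the total multiplicity to be $n$. Let $V=\mathbb{F}_3^m$ carry a nondegenerate symmetric bilinear form with discriminant (determinant of a Gram matrix) $\delta=\pm1$. The sign $\epsilon$ of $V$ is defined by $\delta\epsilon=(-1)^{\binom{m+1}{2}}$; for even $m$, $\epsilon=+1$ if the Witt index is $m/2$ and $\epsilon=-1$ if it is $m/2-1$. The space with sign $\epsilon$ is unique up to isometry. ${}^{+}\Omega_m^{\epsilon}(3)$ is the subgroup of the isometry group of $V$ generated by the class $E$ of reflections with centers $\langle x\rangle$ such that the form takes the value $(x,x)=1$; it is a $3$-transposition group with class $E$. Two $3$-transposition groups have the same central type if their quotients by their centers are isomorphic as $3$-transposition groups (matching the images of the generating classes). $(G,D)$ has type $3^{\bullet h}\,{}^{+}\Omega_m^{\epsilon}(3)$ if $G$ has a normal $3$-subgroup $N$ with $|D\cap tN|=3^{h}$ for all $t\in D$ and $(G/N,DN/N)$ has the same central type as $({}^{+}\Omega_m^{\epsilon}(3),E)$. (The extension may be split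 or not.) *)

(* Defs.v *)
From HB Require Import structures.
From mathcomp Require Import all_boot all_order all_algebra all_fingroup.
From mathcomp Require Import all_solvable all_field.

Set Implicit Arguments.
Unset Strict Implicit.
Unset Printing Implicit Defensive.

Import GroupScope GRing.Theory.
Local Open Scope ring_scope.

Definition three_transposition (gT : finGroupType) (G : {group gT})
    (D : {set gT}) : Prop :=
  [/\ D \in classes G,
      <<D>>%g = G,
      forall t, t \in D -> #[t]%g = 2%N
    & forall s t, s \in D -> t \in D -> #[(s * t)%g]%g \in [:: 1; 2; 3]%N].

Definition diagram_adj (gT : finGroupType) : rel gT :=
  fun s t => #[(s * t)%g]%g == 3%N.

Definition diagram_degree (gT : finGroupType) (D : {set gT}) (t : gT) : nat :=
  #|[set s in D | diagram_adj t s]|.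

Definition diagram_mx (gT : finGroupType) (D : {set gT}) : 'M[algC]_#|D| :=
  \matrix_(i, j) (diagram_adj (enum_val i) (enum_val j))%:R.

(* The spectrum is ((k; ..., [r]^c, ..., [r0]^star)), the pairs (r, c) being those
   of s: the diagram is regular of degree k, and the eigenvalues with their
   multiplicities are read off the characteristic polynomial (the matrix is
   real symmetric, so algebraic and geometric multiplicities agree).  Repeated
   values are merged by the product, and the multiplicity c of r0 is forced by
   degrees: 1 + (sum of the multiplicities in s) + c = #|D|. *)
Definition diagram_spectrum (gT : finGroupType) (D : {set gT}) (k : algC)
    (s : seq (algC * nat)) (r0 : algC) : Prop :=
  (forall t, t \in D -> (diagram_degree D t)%:R = k) /\
  exists c : nat,
    char_poly (diagram_mx D) =
      ('X - k%:P) * \prod_(p <- s) ('X - p.1%:P) ^+ p.2 * ('X - r0%:P) ^+ c.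

(* Forms on the row space 'rV['F_3]_m are given by their Gram matrix B. *)
Definition form_val (m : nat) (B : 'M['F_3]_m) (x y : 'rV['F_3]_m) : 'F_3 :=
  (x *m B *m y^T) 0 0.

(* Nondegenerate symmetric form with sign eps, where eps = 1 or -1. *)
Definition form_of_sign (m : nat) (B : 'M['F_3]_m) (eps : int) : Prop :=
  [/\ B^T = B,
      \det B != 0
    & \det B * eps%:~R = (-1) ^+ 'C(m.+1, 2)].

(* Isometries are represented as permutations of the finite set 'rV['F_3]_m;
   the reflection with center <x> is v |-> v - 2 (v, x) / (x, x) x. *)
Definition reflections (m : nat) (B : 'M['F_3]_m) : {set {perm 'rV['F_3]_m}} :=
  [set s : {perm 'rV['F_3]_m} |
    [exists x : 'rV['F_3]_m, (form_val B x x == 1) &&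
      [forall v : 'rV['F_3]_m,
        s v == v - (2 * form_val B v x / form_val B x x) *: x]]].

Definition plusOmega (m : nat) (B : 'M['F_3]_m) : {group {perm 'rV['F_3]_m}} :=
  <<reflections B>>%G.

Definition same_central_type (aT rT : finGroupType)
    (G : {group aT}) (D : {set aT}) (H : {group rT}) (E : {set rT}) : Prop :=
  exists f : {morphism (G / 'Z(G))%g >-> coset_of 'Z(H)%g},
    isom (G / 'Z(G))%g (H / 'Z(H))%g f /\
    (f @* (D / 'Z(G)) = E / 'Z(H))%g.

(* Type 3^{h} +Omega_m^eps(3).  The space of sign eps being unique up to
   isometry, any Gram matrix of that sign may serve. *)
Definition has_type_3_plusOmega (gT : finGroupType) (G : {group gT})
    (D : {set gT}) (h m : nat) (eps : int) : Prop :=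
  exists (N : {group gT}) (B : 'M['F_3]_m),
    [/\ (N <| G)%g,
        (3.-group N)%g,
        forall t, t \in D -> #|D :&: (t *: N)%g| = (3 ^ h)%N,
        form_of_sign B eps
      & same_central_type (G / N)%G (D / N)%g (plusOmega B) (reflections B)].

(* Main.v *)
(* A fibre of D -> D/N is a clique of size 3^h, two elements of different fibres
   are adjacent iff their images are, and passing to the quotient by the center
   is injective on D/N and on the reflections.  So t in D determines up to sign
   a vector x_t of norm 1, every pair {y, -y} arises from 3^h elements, and
   P := A + I has the entries [(x_s, x_t) <> 0].

   The products of two rows of P are sums of additive characters of F_3 over the
   sphere (z, z) = 1.  Completing the square reduces them to the Gauss sum
   \sum_v omega^(v, v) = det(B) theta^m, where theta^2 = -3, and yields
   P (P - a)(P - b) = c J with J the all-ones matrix.  So P is diagonalizable with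
   eigenvalues among 0, a, b and its valency k; k is simple, and the
   multiplicities of a and b follow from the traces of P and of P^2. *)
Require Import Defs.
From mathcomp Require Import all_boot all_order all_algebra all_fingroup.
From mathcomp Require Import all_solvable all_field.
From mathcomp Require Import ring zify.

Set Implicit Arguments.
Unset Strict Implicit.
Unset Printing Implicit Defensive.

Import GRing.Theory Num.Theory.
Local Open Scope ring_scope.

(** * Quadratic forms and Gauss sums over F_3 *)

Lemma F3_cases (c : 'F_3) : [\/ c = 0, c = 1 | c = -1].
Proof.
by case: c => [[|[|[|//]]] lt_c3]; [apply: Or31|apply: Or32|apply: Or33]; apply: val_inj.
Qed.

Lemma F3_sqr (c : 'F_3) : c != 0 -> c * c = 1.
Proof. by case: (F3_cases c) => -> // _; apply: val_inj. Qed.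

(** The quadratic character of F_3, with complex values and extended by 0. *)
Definition F3_sign (c : 'F_3) : algC :=
  if c == 0 then 0 else if c == 1 then 1 else -1.

Lemma F3_signM a b : F3_sign (a * b) = F3_sign a * F3_sign b.
Proof.
by case: (F3_cases a) => ->; case: (F3_cases b) => ->;
  rewrite /F3_sign /= ?(mulr0, mul0r, mulr1, mul1r, mulrNN).
Qed.

Section Form.
Variables (m : nat) (B : 'M['F_3]_m).
Notation q := (form_val B).

Lemma form_valDl x y z : q (x + y) z = q x z + q y z.
Proof. by rewrite /form_val !mulmxDl mxE. Qed.
Lemma form_valDr x y z : q z (x + y) = q z x + q z y.
Proof. by rewrite /form_val raddfD /= mulmxDr mxE. Qed.
Lemma form_valZl a x z : q (a *: x) z = a * q x z.
Proof. by rewrite /form_val -!scalemxAl mxE. Qed.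
Lemma form_valZr a x z : q z (a *: x) = a * q z x.
Proof. by rewrite /form_val linearZ /= -!scalemxAr mxE. Qed.
Lemma form_valNl x z : q (- x) z = - q x z.
Proof. by rewrite -scaleN1r form_valZl mulN1r. Qed.
Lemma form_valNr x z : q z (- x) = - q z x.
Proof. by rewrite -scaleN1r form_valZr mulN1r. Qed.
Lemma form_val0l z : q 0 z = 0.
Proof. by rewrite -(scale0r 0) form_valZl mul0r. Qed.

Hypothesis Bsym : B^T = B.
Lemma form_valC x y : q x y = q y x.
Proof.
rewrite /form_val -[in RHS](trmxK (y *m B *m x^T)) [in RHS]mxE.
by rewrite !trmx_mul trmxK Bsym mulmxA.
Qed.

Lemma form_val_delta i j : q (delta_mx 0 i) (delta_mx 0 j) = B i j.
Proof. by rewrite /form_val trmx_delta -rowE -colE !mxE. Qed.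

Lemma form_val_nondeg u : \det B != 0 -> u != 0 -> exists z, q u z != 0.
Proof.
move=> dB u0; have: u *m B != 0.
  apply: contraNneq u0 => uB0; rewrite -[u](@mulmxK _ _ _ B) ?uB0 ?mul0mx //.
  by rewrite unitmxE unitfE.
case/rV0Pn => i uBi; exists (delta_mx 0 i).
by rewrite /form_val trmx_delta -colE mxE.
Qed.

(** Polarization: if all norms vanish, so does twice each entry of [B], and 2 is invertible in
    F_3. *)
Lemma exists_anisotropic : B != 0 -> exists x, q x x != 0.
Proof.
move=> B0; apply/existsP; apply: contraNT B0.
rewrite negb_exists => /forallP q0; apply/eqP/matrixP => i j.
have {}q0 x : q x x = 0 by apply/eqP; have := q0 x; rewrite negbK.
have := q0 (delta_mx 0 i + delta_mx 0 j).
rewrite form_valDl !form_valDr !q0 (form_valC (delta_mx 0 j)) add0r addr0.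
by rewrite form_val_delta mxE; case: (F3_cases (B i j)) => ->.
Qed.

End Form.

(** One step of orthogonal diagonalization, which drives the induction on the dimension in
    [gauss_sumE]. *)
Lemma split_anisotropic m (B : 'M['F_3]_(1 + m)) :
    B^T = B -> \det B != 0 ->
  exists P : 'M_(1 + m), exists a : 'F_3, exists C : 'M_m,
    [/\ P \in unitmx, C^T = C & P *m B *m P^T = block_mx a%:M 0 0 C].
Proof.
move=> Bs dB; have [|x qx] := exists_anisotropic Bs.
  by apply: contraNneq dB => ->; rewrite det0.
have x0 : x != 0 by apply: contraNneq qx => ->; rewrite form_val0l.
pose R := row_ebase x.
have RU : R \in unitmx by apply: row_ebase_unit.
(* The rank factorization of the nonzero row [x] makes it a multiple of the first row of the
   invertible matrix [R]. *)
have [c cx] : exists c : 'F_3, x = c *: row (lshift m 0) R.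
  exists (col_ebase x 0 0).
  rewrite -{1}[x]mulmx_ebase rank_rV x0 -mul_scalar_mx -[(col_ebase x 0 0)%:M]mx11_scalar.
  rewrite -mulmxA; congr (_ *m _); rewrite rowE; congr (_ *m _).
  apply/matrixP => i j; rewrite !mxE !ord1 -val_eqE /=.
  by rewrite andbT -val_eqE /= eq_sym.
pose B1 := R *m B *m R^T.
have B1s : B1^T = B1 by rewrite /B1 !trmx_mul trmxK Bs mulmxA.
pose a := ulsubmx B1 0 0; pose b := ursubmx B1; pose C := drsubmx B1.
have ulE : ulsubmx B1 = a%:M by rewrite [LHS]mx11_scalar.
have a0 : a != 0.
  apply: contraNneq qx => a0; rewrite cx form_valZl form_valZr.
  suff -> : form_val B (row (lshift m 0) R) (row (lshift m 0) R) = a.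
    by rewrite a0 !mulr0.
  rewrite /a /B1 /form_val -row_mul !mxE; apply: eq_bigr => k _.
  by rewrite !mxE.
have B1E : B1 = block_mx a%:M b b^T C.
  rewrite -[LHS]submxK ulE; congr block_mx.
  by rewrite -[in LHS]B1s -trmx_ursub.
have Cs : C^T = C by rewrite /C trmx_drsub B1s.
(* [T] clears the block below [a]: its lower left block is - b^T / a, because a nonzero element of
   F_3 is its own inverse. *)
pose T : 'M['F_3]_(1 + m) := block_mx 1%:M 0 (- (a *: b^T)) 1%:M.
exists (T *m R), a, (C - a *: (b^T *m b)); split.
- rewrite unitmx_mul RU andbT unitmxE det_lblock !det1 mulr1 unitr1 //.
- by rewrite raddfB /= Cs linearZ /= trmx_mul trmxK.
rewrite trmx_mul !mulmxA -(mulmxA T) -(mulmxA T) -/B1 B1E.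
rewrite tr_block_mx !mulmx_block !trmx1 !trmx0 !raddfN /= !linearZ /= trmxK.
rewrite !(mul1mx, mulmx1, mul0mx, mulmx0, addr0, add0r).
rewrite mul_scalar_mx mul_mx_scalar !(scalerN, scalerA) F3_sqr // !scale1r.
by rewrite !addNr mul0mx scaler0 oppr0 add0r addrC mulNmx -scalemxAl.
Qed.

Section Gauss.
Variable theta : algC.
Hypothesis theta2 : theta ^+ 2 = - 3.

(* (theta - 1) / 2 is a primitive cube root of unity. *)
Definition F3_char (c : 'F_3) : algC :=
  if c == 0 then 1 else if c == 1 then (theta - 1) / 2 else (- theta - 1) / 2.

Lemma F3_charD a b : F3_char (a + b) = F3_char a * F3_char b.
Proof.
have t2 : theta * theta = -3 by rewrite -expr2.
by case: (F3_cases a) => ->; case: (F3_cases b) => ->; rewrite /F3_char /=;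
   field: t2.
Qed.

Lemma F3_char0 : F3_char 0 = 1. Proof. by []. Qed.

Lemma F3_char_neq1 c : c != 0 -> F3_char c != 1.
Proof.
have H (s : algC) : s ^+ 2 = -3 -> (s - 1) / 2 != 1.
  move=> s2; apply/eqP => s1; have s3 : s = 3.
    by transitivity ((s - 1) / 2 * 2 + 1); [field | rewrite s1; ring].
  by move/eqP: s2; rewrite s3 -subr_eq0 opprK -natrX -natrD pnatr_eq0.
case: (F3_cases c) => -> // _; first exact: H.
by apply: H; rewrite sqrrN.
Qed.

Lemma sum_F3 (f : 'F_3 -> algC) : \sum_c f c = f 0 + f 1 + f (-1).
Proof.
rewrite !big_ord_recl big_ord0 addr0 !addrA; congr (f _ + f _ + f _); exact: val_inj.
Qed.

Lemma gauss_sum1 a : a != 0 -> \sum_(t : 'F_3) F3_char (a * (t * t)) = F3_sign a * theta.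
Proof.
by case: (F3_cases a) => -> // _; rewrite sum_F3 /F3_char /F3_sign /=; field.
Qed.

Definition gauss_sum m (B : 'M['F_3]_m) := \sum_(v : 'rV_m) F3_char (form_val B v v).

(** Splitting off an orthogonal line factors the sum into a one-dimensional Gauss sum and a sum of
    the same kind in dimension one less. *)
Lemma gauss_sumE m (B : 'M['F_3]_m) : B^T = B -> \det B != 0 ->
  gauss_sum B = F3_sign (\det B) * theta ^+ m.
Proof.
elim: m B => [|m IHm] B Bs dB.
  rewrite det_mx00 /gauss_sum (big_pred1 0) => [|v]; last by apply/esym/eqP/rowP; case.
  by rewrite form_val0l /F3_sign /= expr0 mul1r.
have [P [a [C [PU Cs PBP]]]] := split_anisotropic Bs dB.
(* A change of basis multiplies the determinant by a nonzero square, which is 1 in F_3. *)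
have detE : \det (P *m B *m P^T) = \det B.
  rewrite !det_mulmx det_tr mulrC mulrA F3_sqr ?mul1r //.
  by rewrite -unitfE -unitmxE.
rewrite -detE PBP (@det_ublock _ 1) det_scalar1 F3_signM.
have [a0 dC] : a != 0 /\ \det C != 0.
  by apply/andP; rewrite -negb_or -mulf_eq0 -[a]det_scalar1 -(@det_ublock _ 1 _ _ 0) -PBP detE.
rewrite exprS mulrACA -IHm // -gauss_sum1 // /gauss_sum.
rewrite (reindex (mulmxr P)) /=; last first.
  by exists (mulmxr (invmx P)) => v _; rewrite /= ?mulmxK ?mulmxKV.
pose h (p : 'F_3 * 'rV['F_3]_m) : 'rV_(1 + m) := row_mx p.1%:M p.2.
rewrite (reindex h) /=; last first.
  exists (fun v => (lsubmx v 0 0, rsubmx v)) => [[t u]|v] _ /=.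
    by rewrite /h /= row_mxKl row_mxKr mxE.
  by rewrite /h /= -mx11_scalar hsubmxK.
rewrite big_distrlr /= pair_bigA /=; apply: eq_bigr => [[t u] _] /=.
rewrite -F3_charD; congr F3_char.
rewrite /form_val trmx_mul !mulmxA -(mulmxA (h _)) -(mulmxA (h _)) PBP.
rewrite /h /= mul_row_block tr_row_mx mul_row_col !mulmx0 addr0 add0r mxE.
by rewrite -scalar_mxM tr_scalar_mx -scalar_mxM mxE mulr1n [t * a]mulrC mulrA.
Qed.

End Gauss.

(** * Exponential sums over the unit sphere *)

Section KernelSums.
Variables (theta : algC) (theta2 : theta ^+ 2 = - 3).
Variables (m : nat) (B : 'M['F_3]_m) (Bs : B^T = B) (dB : \det B != 0).
Notation q := (form_val B).
Notation chi := (F3_char theta).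

Let g1 := gauss_sum theta B.
(** Replacing theta by - theta inverts the character, so [g2] is the sum of chi (- (v, v)). *)
Let g2 := gauss_sum (- theta) B.

Lemma F3_charN c : F3_char (- theta) c = chi (- c).
Proof. by case: (F3_cases c) => ->; rewrite /F3_char /= ?opprK. Qed.

(** Orthogonality of characters: for nonzero u, a translation by some w with (u, w) nonzero
    multiplies the sum by a factor other than 1. *)
Lemma sum_char_form u : \sum_z chi (q u z) = (u == 0)%:R * 3 ^+ m.
Proof.
have [->|u0] := eqVneq.
  under eq_bigr do rewrite form_val0l F3_char0.
  by rewrite sumr_const card_mx card_Fp // mul1n mul1r -natrX.
have [w qw] := form_val_nondeg dB u0.
have : (1 - chi (q u w)) * \sum_z chi (q u z) = 0.
  rewrite mulrBl mul1r mulr_sumr [X in X - _](reindex_inj (addrI w)) /=.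
  by under eq_bigr do rewrite form_valDr F3_charD //; rewrite subrr.
by move/eqP; rewrite mulf_eq0 subr_eq0 eq_sym (negPf (F3_char_neq1 _ qw)) //= mul0r => /eqP.
Qed.

Lemma sum_char_quadratic (t : 'F_3) u : t != 0 ->
  \sum_z chi (t * q z z + q u z) = chi (- (t * q u u)) * \sum_z chi (t * q z z).
Proof.
(* z is replaced by z + t u, which completes the square because 2 = -1 and t^2 = 1. *)
move=> t0; rewrite mulr_sumr (reindex_inj (addrI (t *: u))) /=.
apply: eq_bigr => z _; rewrite -F3_charD //; congr chi.
rewrite !(form_valDl, form_valDr, form_valZl, form_valZr) (form_valC Bs z u).
by case: (F3_cases t) t0 => -> // _; case: (F3_cases (q u u)) => ->; case: (F3_cases (q u z)) => ->;
  case: (F3_cases (q z z)) => ->; apply: val_inj.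
Qed.

(** The Fourier transform of the indicator function of the unit sphere. *)
Definition sphere_sum u := \sum_(z | q z z == 1) chi (q u z).

Lemma F3_indicator c : 3 * (c == 1)%:R = 1 + chi (c - 1) + chi (1 - c).
Proof. by case: (F3_cases c) => ->; rewrite /F3_char /=; field. Qed.

(** Expanding the condition (z, z) = 1 by [F3_indicator] leaves one linear and two quadratic
    exponential sums. *)
Lemma sphere_sumE u :
  sphere_sum u = ((u == 0)%:R * 3 ^+ m
     + chi (- 1 - q u u) * g1 + chi (1 + q u u) * g2) / 3.
Proof.
apply: canRL (mulfK _) _; rewrite ?pnatr_eq0 // mulrC /sphere_sum.
rewrite big_mkcond mulr_sumr /=.
rewrite (eq_bigr (fun z => chi (q u z) + chi (-1) * chi (1 * q z z + q u z)
   + chi 1 * chi (-1 * q z z + q u z))); last first.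
  move=> z _; transitivity (3 * (q z z == 1)%:R * chi (q u z)).
    by case: (_ == 1); rewrite ?mulr1 // !mulr0 mul0r.
  by rewrite F3_indicator !mulrDl !mul1r mulN1r -!(F3_charD theta2) !addrA (addrC (-1)).
rewrite !big_split /= -!mulr_sumr sum_char_form !sum_char_quadratic ?oppr_eq0 //.
rewrite !mulrA -!(F3_charD theta2) mul1r mulN1r opprK; congr (_ + _ * _ + _ * _).
  by apply: eq_bigr => z _; rewrite mul1r.
by apply: eq_bigr => z _; rewrite mulN1r F3_charN.
Qed.

Definition form_ker x y : algC := (q x y != 0)%:R.

(** The indicator of (x, y) = 0 is the average of three characters. This turns sums of the kernel
    over the sphere into values of [sphere_sum]. *)
Lemma form_kerE x y : form_ker x y = (2 - chi (q x y) - chi (- q x y)) / 3.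
Proof.
by rewrite /form_ker; case: (F3_cases (q x y)) => ->; rewrite /F3_char /=; field.
Qed.

(* gauss_sumE: g1 = det(B) theta^m and g2 = det(B) (- theta)^m, so s = 0 for odd m and d = 0
   for even m. *)
Let s := g1 + g2.
Let d := theta * (g1 - g2).

Lemma sphere_sum0 : sphere_sum 0 = (2 * 3 ^+ m - s - d) / 6.
Proof.
rewrite sphere_sumE form_val0l subr0 addr0 eqxx mul1r.
by rewrite /s /d /F3_char /=; field.
Qed.

Lemma sphere_card : \sum_(z | q z z == 1) 1 = (2 * 3 ^+ m - s - d) / 6.
Proof.
by rewrite -sphere_sum0 /sphere_sum; under [RHS]eq_bigr do rewrite form_val0l F3_char0.
Qed.

Lemma sphere_sumN u : sphere_sum (- u) = sphere_sum u.
Proof.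
rewrite /sphere_sum (reindex_inj oppr_inj) /=.
apply: eq_big => z; first by rewrite form_valNl form_valNr opprK.
by move=> _; rewrite form_valNl form_valNr opprK.
Qed.

Lemma sphere_sum_unit x : q x x = 1 -> sphere_sum x = (d - s) / 6.
Proof.
move=> qx; have x0 : x != 0 by apply: contra_eqN qx => /eqP->; rewrite form_val0l eq_sym.
rewrite sphere_sumE qx (negPf x0) mul0r add0r.
by rewrite /s /d /F3_char /=; field.
Qed.

Lemma form_ker_row x : q x x = 1 ->
  \sum_(z | q z z == 1) form_ker x z = 2 * (3 ^+ m - d) / 9.
Proof.
move=> qx.
transitivity ((2 * sphere_sum 0 - sphere_sum x - sphere_sum (- x)) / 3).
  rewrite /sphere_sum mulr_sumr -!sumrB mulr_suml; apply: eq_bigr => z _.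
  by rewrite form_kerE form_val0l form_valNl F3_char0 mulr1.
by rewrite sphere_sumN sphere_sum0 (sphere_sum_unit qx); field.
Qed.

(** For orthogonal x and y both x + y and x - y have norm -1; otherwise their norms are 0 and 1 in
    some order, and the terms in [d] cancel. The term 3^m appears when one of the two vectors is
    zero. *)
Lemma sphere_sum_pm x y : q x x = 1 -> q y y = 1 ->
  sphere_sum (x + y) + sphere_sum (x - y) =
  (((x == y) || (x == - y))%:R * 3 ^+ m + s * (2 - 3 * form_ker x y)) / 3.
Proof.
move=> qx qy; rewrite !sphere_sumE addr_eq0 subr_eq0.
have -> : ((x == y) || (x == - y))%:R = (x == -y)%:R + (x == y)%:R :> algC.
  case: (eqVneq x y) => [->|_]; last by rewrite addr0.
  have y0 : y != 0 by apply: contra_eqN qy => /eqP->; rewrite form_val0l eq_sym.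
  suff /negPf-> : y != - y by rewrite add0r.
  by rewrite -addr_eq0 -mulr2n -scaler_nat scaler_eq0 negb_or y0.
rewrite !(form_valDl, form_valDr, form_valNl, form_valNr) qx qy (form_valC Bs y x).
by rewrite /form_ker /s; case: (F3_cases (q x y)) => ->; rewrite /F3_char /=; field.
Qed.

(** The product of two expansions [form_kerE] has nine terms. Only the four at x + y, x - y and
    their negatives depend on more than the norms of x and y, and [sphere_sum_pm] evaluates them. *)
Lemma form_ker_sqr x y : q x x = 1 -> q y y = 1 ->
  \sum_(z | q z z == 1) form_ker x z * form_ker z y =
  2 * (2 * 3 ^+ m + 3 * s - 3 * d - 3 * s * form_ker x y
       + ((x == y) || (x == - y))%:R * 3 ^+ m) / 27.
Proof.
move=> qx qy.
transitivity ((4 * sphere_sum 0 - 2 * sphere_sum x - 2 * sphere_sum (- x) - 2 * sphere_sum y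
  - 2 * sphere_sum (- y) + sphere_sum (x + y) + sphere_sum (x - y)
  + sphere_sum (- (x - y)) + sphere_sum (- (x + y))) / 9).
  rewrite /sphere_sum !mulr_sumr -!(sumrB, big_split) /= mulr_suml; apply: eq_bigr => z _.
  rewrite !form_kerE (form_valC Bs z y) form_val0l !(form_valNl, form_valDl).
  by rewrite !opprD !opprK !(F3_charD theta2) F3_char0; field.
rewrite !sphere_sumN; have := sphere_sum_pm qx qy.
rewrite sphere_sum0 (sphere_sum_unit qx) (sphere_sum_unit qy) => exy.
by move/(canRL (addrK _)): exy => ->; field.
Qed.

End KernelSums.

(** * Matrices with three nonzero eigenvalues *)

(** Stated for an arbitrary commutative law because it serves both for traces (sums) and for the
    characteristic polynomial (a product). *)
Lemma big_values (R : Type) (idx : R) (op : Monoid.com_law idx) (I : finType)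
    (T : eqType) (rs : seq T) (d : I -> T) (F : T -> R) :
  uniq rs -> (forall i, d i \in rs) ->
  \big[op/idx]_i F (d i) = \big[op/idx]_(r <- rs) \big[op/idx]_(i | d i == r) F r.
Proof.
move=> rs_uniq d_rs; rewrite (exchange_big_dep predT) //=.
apply: eq_bigr => i _; rewrite big_mkcond (bigD1_seq (d i)) //= eqxx big1 ?Monoid.mulm1 //.
by move=> r; rewrite eq_sym => /negPf->.
Qed.

Lemma three_eigenvalues n (P : 'M[algC]_n) (k a b c : algC) :
    let J : 'M[algC]_n := const_mx 1 in
    (0 < n)%N -> uniq [:: 0; a; b; k] ->
    J *m P = k *: J ->
    P *m P *m P - (a + b) *: (P *m P) + (a * b) *: P = c *: J ->
  exists f g z : nat,
    [/\ char_poly (P - 1%:M) = ('X - (k - 1)%:P) * ('X - (a - 1)%:P) ^+ f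
          * ('X - (b - 1)%:P) ^+ g * ('X + 1) ^+ z,
        \tr P = k + a *+ f + b *+ g &
        \tr (P *m P) = k ^+ 2 + a ^+ 2 *+ f + b ^+ 2 *+ g].
Proof.
case: n P => // n P J _ rs_uniq JP PJ; set rs := [:: 0; a; b; k] in rs_uniq.
pose p3 : {poly algC} := 'X * ('X - a%:P) * ('X - b%:P).
have p3P : horner_mx P p3 = c *: J.
  rewrite -PJ /p3 !rmorphM !rmorphB /= !horner_mx_X !horner_mx_C.
  rewrite -!mulmxE !mulmxBr !mul_mx_scalar mulmxBl -scalemxAl scalerBr scalerA.
  by rewrite scalerDl !opprD opprK (mulrC b) !addrA.
(* The factor X - k annihilates c J because J P = k J. The four roots being distinct, P is
   diagonalizable. *)
have rsP : horner_mx P (\prod_(x <- rs) ('X - x%:P)) = 0.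
  rewrite !big_cons big_nil mulr1 subr0 !mulrA rmorphM /= p3P.
  rewrite rmorphB /= horner_mx_X horner_mx_C mulrBr -!mulmxE -scalemxAl JP.
  by rewrite mul_mx_scalar !scalerA mulrC subrr.
have [Q QU /diagonalizable_forPex[d /(simmxLR QU)]] : diagonalizable P.
  by apply/diagonalizableP; exists rs; rewrite ?mxminpoly_min.
rewrite mxpoly.conjVmx // => PE.
pose V := invmx Q; have VU : V \in unitmx by rewrite unitmx_inv.
have hornP p : horner_mx P p = V *m diag_mx (map_mx (horner p) d) *m Q.
  by rewrite PE horner_mx_uconjC // horner_mx_diag.
have trP p : \tr (horner_mx P p) = \sum_i p.[d 0 i].
  rewrite hornP mxtrace_mulC mulmxA mulmxV // mul1mx mxtrace_diag.
  by apply: eq_bigr => i _; rewrite mxE.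
have d_rs i : d 0 i \in rs.
  have := hornP (\prod_(x <- rs) ('X - x%:P)); rewrite rsP => /esym.
  move/(congr1 (fun M => Q *m M *m V)); rewrite mulmx0 mul0mx !mulmxA mulmxK //.
  rewrite mulmxV // mul1mx => /matrixP/(_ i i)/eqP.
  by rewrite !mxE eqxx mulr1n -[_ == 0]/(root _ _) root_prod_XsubC.
pose cnt r := #|[pred i | d 0 i == r]|.
have trE p : \tr (horner_mx P p) = p.[0] *+ cnt 0 + p.[a] *+ cnt a
    + p.[b] *+ cnt b + p.[k] *+ cnt k.
  rewrite trP (big_values _ (horner p) rs_uniq d_rs) /= !big_cons big_nil addr0 !addrA.
  by rewrite !sumr_const.
have p3_0 : [/\ p3.[0] = 0, p3.[a] = 0 & p3.[b] = 0].
  by rewrite /p3 !hornerE; split; ring.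
(* J times p3(P) is computed in two ways: as p3(k) J, by J P = k J, and as c J^2, whose entries are
   c times the size of the matrix. *)
have cnE : c *+ n.+1 = p3.[k].
  have : J *m horner_mx P p3 = p3.[k] *: J.
    elim/poly_ind: p3 {p3P p3_0} => [|p e IH].
      by rewrite rmorph0 mulmx0 horner0 scale0r.
    rewrite rmorphD rmorphM /= horner_mx_X horner_mx_C mulmxDr -mulmxE mulmxA IH.
    by rewrite -scalemxAl JP scalerA mul_mx_scalar -scalerDl !hornerE.
  rewrite p3P -scalemxAr => /matrixP/(_ 0 0); rewrite !mxE mulr1 => <-.
  by under eq_bigr do rewrite !mxE mulr1; rewrite sumr_const card_ord mulr_natr.
(* In the trace of p3(P) = c J only the eigenvalue k contributes; the trace also equals p3(k), which
   is nonzero, so k is simple. *)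
have k1 : cnt k = 1%N.
  have := trE p3; rewrite p3P; case: p3_0 => -> -> ->; rewrite !mul0rn !add0r -cnE.
  rewrite mxtraceZ (_ : \tr J = n.+1%:R); last first.
    by rewrite /mxtrace; under eq_bigr do rewrite mxE; rewrite sumr_const card_ord.
  have p3k : p3.[k] != 0.
    rewrite /p3 !hornerE !mulf_eq0 !subr_eq0 !(eq_sym k).
    by move: rs_uniq; rewrite /= !inE; do 3!case: (_ == k); rewrite ?orbT ?andbF.
  rewrite mulr_natr cnE -mulr_natr -{1}[p3.[k]]mulr1 => /(mulfI p3k)/esym/eqP.
  by rewrite pnatr_eq1 => /eqP.
exists (cnt a), (cnt b), (cnt 0); split.
- have -> : P - 1%:M = V *m diag_mx (d - const_mx 1) *m Q.
    rewrite raddfB /= mulmxBr mulmxBl -PE diag_const_mx mulmx1 mulVmx //.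
  have -> : char_poly (V *m diag_mx (d - const_mx 1) *m Q)
      = char_poly (diag_mx (d - const_mx 1)).
    rewrite /char_poly; transitivity (\det (map_mx polyC V *m
        char_poly_mx (diag_mx (d - const_mx 1)) *m map_mx polyC Q)).
      congr (\det _); rewrite /char_poly_mx mulmxBr mulmxBl -!map_mxM.
      by rewrite mul_mx_scalar -scalemxAl -map_mxM mulVmx // map_mx1 scalemx1.
    rewrite !det_mulmx mulrAC -det_mulmx -map_mxM mulVmx // map_mx1 det1 mul1r //.
  rewrite char_poly_trig ?is_diag_mx_is_trig ?diag_mx_is_diag //.
  rewrite (eq_bigr (fun i => 'X - (d 0 i - 1)%:P)) => [|i _]; last first.
    by rewrite !mxE eqxx mulr1n.
  rewrite (big_values _ (fun r => 'X - (r - 1)%:P) rs_uniq d_rs) !big_cons big_nil.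
  rewrite !prodr_const -/(cnt 0) -/(cnt a) -/(cnt b) -/(cnt k) k1 sub0r polyCN opprK /=; ring.
- have := trE 'X; rewrite horner_mx_X !hornerX => ->.
  by rewrite mul0rn k1 mulr1n; ring.
have := trE 'X^2; rewrite rmorphXn /= horner_mx_X !hornerXn => ->.
by rewrite expr0n mul0rn k1 mulr1n; ring.
Qed.

(** * Diagrams and their quotients *)

Section Adjacency.
Local Open Scope group_scope.

(** Asking for t^2 = 1 instead of order exactly 2 makes the condition pass to homomorphic images,
    where an element may become trivial. *)
Definition diagram_ok (gT : finGroupType) (D : {set gT}) : Prop :=
  (forall t, t \in D -> t * t = 1) /\
  (forall s t, s \in D -> t \in D -> #[s * t] \in [:: 1; 2; 3]%N).

Lemma order_123_dvd (gT : finGroupType) (x : gT) (n : nat) :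
  n \in [:: 1; 2; 3]%N -> (#[x] %| n)%N -> #[x] \in [:: 1; 2; 3]%N.
Proof.
rewrite !inE => n123; have n_gt0 : (0 < n)%N by case/or3P: n123 => /eqP->.
move/(dvdn_leq n_gt0); have := order_gt0 x.
by case: #[x] => [|[|[|[|k]]]] //; case/or3P: n123 => /eqP->.
Qed.

Lemma involV (gT : finGroupType) (t : gT) : t * t = 1 -> t^-1 = t.
Proof. by move=> /eqP; rewrite -eq_invg_mul => /eqP. Qed.

Variables (gT : finGroupType).
Implicit Types (G H : {group gT}) (D : {set gT}).

(** The order of the image of s t divides that of s t, and it is 1 exactly when the images of s and
    t coincide. *)
Lemma diagram_adj_morph (rT : finGroupType) G D (f : {morphism G >-> rT}) s t :
    diagram_ok D -> D \subset G -> s \in D -> t \in D ->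
  diagram_adj (f s) (f t) = diagram_adj s t && (f s != f t).
Proof.
case=> inv ord /subsetP DG sD tD; have [sG tG] := (DG _ sD, DG _ tD).
rewrite /diagram_adj -morphM //.
have -> : (f s == f t) = (#[f (s * t)] == 1%N).
  by rewrite order_eq1 morphM // -eq_invg_mul involV // -morphM // inv // morph1.
have := morph_order f (groupM sG tG); have := order_gt0 (f (s * t)).
have := ord _ _ sD tD; rewrite !inE => /or3P[]/eqP-> /=;
  by case: #[f (s * t)] => [|[|[|[|k]]]] // _ /dvdn_leq => /(_ isT).
Qed.

Lemma diagram_ok_morph (rT : finGroupType) G D (f : {morphism G >-> rT}) :
  diagram_ok D -> D \subset G -> diagram_ok (f @* D).
Proof.
case=> inv ord DG; split.
  move=> _ /morphimP[t tG tD ->].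
  by rewrite -morphM // inv // morph1.
move=> _ _ /morphimP[s sG sD ->] /morphimP[t tG tD ->].
by rewrite -morphM //; apply: order_123_dvd (ord _ _ sD tD) (morph_order _ _); apply: groupM.
Qed.

(* If s and t differ by a central z and r is adjacent to s, then rt = (rs)z
   with z of order at most 2, so rt would have order 6 unless z = 1. *)
Lemma center_coset_inj G D r s t :
    diagram_ok D -> D \subset G -> r \in D -> s \in D -> t \in D ->
  diagram_adj r s -> coset 'Z(G) s = coset 'Z(G) t -> s = t.
Proof.
case=> inv ord /subsetP DG rD sD tD /eqP ors eq_st.
have NZ := subsetP (normal_norm (center_normal G)).
have sG := DG _ sD; have tG := DG _ tD; have rG := DG _ rD.
pose z := s * t.
have zZ : z \in 'Z(G).
  rewrite /z -(involV (inv _ sD)); apply: coset_idr; first by rewrite NZ ?groupM ?groupV.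
  by rewrite morphM ?morphV ?NZ ?groupV //= eq_st mulVg.
have cz u : u \in G -> commute u z.
  by move=> uG; case/centerP: zZ => _ /(_ u uG).
have z2 : z ^+ 2 = 1.
  have := cz s sG; rewrite /commute /z mulgA inv // mul1g => e.
  by rewrite expgS expg1 /z mulgA -e inv.
have rt : r * t = (r * s) * z by rewrite /z !mulgA -(mulgA r) inv // mulg1.
have crs : commute (r * s) z by apply: cz; rewrite groupM.
have := ord _ _ rD tD; rewrite rt !inE => orz.
suff z1 : z = 1 by rewrite -(involV (inv _ tD)); apply/eqP; rewrite eq_mulgV1 invgK -/z z1.
have [] : (#[r * s * z] %| 2)%N \/ (#[r * s * z] %| 3)%N.
- by case/or3P: orz => /eqP ->; [left|left|right].
- by rewrite order_dvdn expgMn // z2 mulg1 -order_dvdn ors.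
rewrite order_dvdn expgMn // -[in X in X * _]ors expg_order mul1g.
by rewrite expgS z2 mulg1 => /eqP.
Qed.
End Adjacency.

(** * Reflections as 3-transpositions *)

Lemma F3_triple (a : 'F_3) : a + (a + a) = 0.
Proof. by case: (F3_cases a) => ->; apply: val_inj. Qed.

Section Reflections.
Variables (m : nat) (B : 'M['F_3]_m) (Bs : B^T = B).
Notation q := (form_val B).
Notation E := (reflections B).

(* The reflection is v |-> v + (v, x) x because -2 = 1 in F_3 and (x, x) = 1. *)
Definition refl_center (s : {perm 'rV['F_3]_m}) : 'rV['F_3]_m :=
  odflt 0 [pick x | (q x x == 1) && [forall v, s v == v + q v x *: x]].

Lemma refl_centerP s : s \in E ->
  q (refl_center s) (refl_center s) = 1 /\
  forall v, s v = v + q v (refl_center s) *: refl_center s.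
Proof.
rewrite inE /refl_center; case: pickP => [x /andP[/eqP qx /forallP sE] _ | no].
  by split=> // v; apply/eqP.
case/existsP => x /andP[/eqP qx /forallP sE]; have /negP[] := negbT (no x).
rewrite qx eqxx; apply/forallP => v; rewrite (eqP (sE v)) qx divr1 -scaleNr.
by apply/eqP; congr (_ + _ *: _); case: (F3_cases (q v x)) => ->; apply: val_inj.
Qed.

Lemma reflection_of_center x : q x x = 1 ->
  exists2 s, s \in E & refl_center s = x \/ refl_center s = - x.
Proof.
move=> qx; pose f v := v + q v x *: x.
have fK : involutive f.
  move=> v; rewrite /f form_valDl form_valZl qx mulr1 -addrA -scalerDl.
  by rewrite F3_triple scale0r addr0.
pose s := perm (inv_inj fK); have sE v : s v = v + q v x *: x by rewrite permE.
have s_E : s \in E.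
  rewrite inE; apply/existsP; exists x; rewrite qx eqxx; apply/forallP => v.
  rewrite sE divr1 -scaleNr.
  by apply/eqP; congr (_ + _ *: _); case: (F3_cases (q v x)) => ->; apply: val_inj.
exists s => //; have [qy syE] := refl_centerP s_E.
(* Both centers send x to the same vector, whence (x, y) y = x; so y is x or - x. *)
have := sE x; rewrite syE qx scale1r => /addrI.
set y := refl_center s in qy *.
case: (F3_cases (q x y)) => ->; rewrite ?scale0r ?scale1r ?scaleN1r.
- by move=> x0; move: qx; rewrite -x0 form_val0l => /eqP; rewrite eq_sym oner_eq0.
- by left.
- by move=> <-; right; rewrite opprK.
Qed.

Lemma refl_center_inj s t : s \in E -> t \in E ->
  refl_center s = refl_center t \/ refl_center s = - refl_center t -> s = t.
Proof.
move=> /refl_centerP[_ sE] /refl_centerP[_ tE] st; apply/permP => v; rewrite sE tE.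
by case: st => ->; rewrite // form_valNr scaleNr scalerN opprK.
Qed.

Lemma reflectionsK s : s \in E -> (s * s = 1)%g.
Proof.
move=> /refl_centerP[]; set x := refl_center s => qx sE; apply/permP => v.
rewrite permM perm1 !sE form_valDl form_valZl qx mulr1 -addrA -scalerDl.
by rewrite F3_triple scale0r addr0.
Qed.

Lemma reflections_commute s t : s \in E -> t \in E ->
  q (refl_center s) (refl_center t) = 0 -> (s * t = t * s)%g.
Proof.
move=> /refl_centerP[]; set x := refl_center s => qx sE.
move=> /refl_centerP[]; set y := refl_center t => qy tE qxy.
apply/permP => v; rewrite !permM !sE !tE !(form_valDl, form_valZl) (form_valC Bs y x) qxy.
by rewrite !mulr0 !addr0 addrAC.
Qed.

Lemma reflections_braid s t : s \in E -> t \in E ->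
  q (refl_center s) (refl_center t) != 0 -> (s * t * s = t * s * t)%g.
Proof.
move=> /refl_centerP[]; set x := refl_center s => qx sE.
move=> /refl_centerP[]; set y := refl_center t => qy tE qxy.
apply/permP => v; rewrite !permM !(sE, tE).
rewrite !(form_valDl, form_valZl) (form_valC Bs y x) qx qy.
have cc := F3_sqr qxy; move: (q x y) (q v x) (q v y) cc => c a b cc.
apply/rowP => i; rewrite !mxE; apply/eqP; rewrite -subr_eq0; apply/eqP.
(* Once c^2 = 1 is used, the two sides differ by 3 a x - 3 b y. *)
transitivity ((a + (a + a)) * x 0 i - (b + (b + b)) * y 0 i); first by ring: cc.
by rewrite !F3_triple !mul0r subrr.
Qed.

(** Orthogonal centers give commuting reflections, so (s t)^2 = 1. Otherwise the braid relation
    gives (s t)^3 = (s t s)(t s t) = (s t s)^2 = 1. *)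
Lemma reflections_order s t : s \in E -> t \in E ->
  [/\ #[s * t]%g \in [:: 1; 2; 3]%N &
      diagram_adj s t = (s != t) && (q (refl_center s) (refl_center t) != 0)].
Proof.
move=> sE tE; have [sK tK] := (reflectionsK sE, reflectionsK tE).
have [e|ne] := eqVneq (q (refl_center s) (refl_center t)) 0.
  have st2 : (#[s * t]%g %| 2)%N.
    rewrite order_dvdn; apply/eqP; transitivity (s * t * (s * t))%g => //.
    by rewrite {1}(reflections_commute sE tE e) mulgA -(mulgA t) sK mulg1 tK.
  split; first by apply: (@order_123_dvd _ _ 2).
  by rewrite andbF /diagram_adj; case: #[_]%g st2 => [|[|[|[|]]]] // k /dvdn_leq => /(_ isT).
have st3 : (#[s * t]%g %| 3)%N.
  rewrite order_dvdn; apply/eqP; transitivity (s * t * (s * t * (s * t)))%g => //.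
  transitivity (s * t * s * (t * s * t))%g; first by rewrite !mulgA.
  rewrite -(reflections_braid sE tE ne) !mulgA -(mulgA _ s s) sK mulg1.
  by rewrite -(mulgA _ t t) tK mulg1 sK.
split; first by apply: (@order_123_dvd _ _ 3).
rewrite andbT /diagram_adj.
have -> : (s == t) = (#[s * t]%g == 1%N).
  by rewrite order_eq1 -eq_invg_mul (involV sK).
by move/prime_nt_dvdP: st3; case: eqP => [->|] // h -> //; apply/eqP.
Qed.

Lemma reflections_ok : diagram_ok E.
Proof. by split=> [s /reflectionsK|s t sE tE] //; case: (reflections_order sE tE). Qed.

End Reflections.

(** The vector of t is reached from D through D / N, its central quotient, the isomorphism [f], a
    lift to a reflection, and the center of that reflection. The last hypothesis gives every
    reflection a neighbour, which [center_coset_inj] requires for injectivity on both central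
    quotients. *)
Lemma plusOmega_coordinates (h m : nat) (gT : finGroupType) (G N : {group gT})
    (D : {set gT}) (B : 'M['F_3]_m) :
  let q := form_val B in
  three_transposition G D -> (N <| G)%g -> (3.-group N)%g ->
  (forall t, t \in D -> #|D :&: (t *: N)%g| = (3 ^ h)%N) -> B^T = B ->
  same_central_type (G / N)%G (D / N)%g (plusOmega B) (reflections B) ->
  (forall x, q x x = 1 -> exists y, [/\ q y y = 1, q y x != 0, y != x & y != - x]) ->
  exists x : gT -> 'rV['F_3]_m,
    [/\ forall t, t \in D -> q (x t) (x t) = 1,
        forall s t, s \in D -> t \in D ->
          (s == t) || diagram_adj s t = (q (x s) (x t) != 0) &
        forall y, q y y = 1 ->
          #|[set s in D | (x s == y) || (x s == - y)]| = (3 ^ h)%N].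
Proof.
move=> q [_ genD ordD ordDD] nNG pN fibN Bs [f [/isomP[injf _] fD]] neighbor.
have okD : diagram_ok D.
  by split=> // t tD; apply/eqP; rewrite -expg2 -order_dvdn ordD.
have DG : D \subset G by rewrite -genD subset_gen.
have DN : D \subset 'N(N)%g := subset_trans DG (normal_norm nNG).
set E := reflections B in fD; set H := plusOmega B in f injf fD *.
set Gb := (G / N)%G in f injf fD *; set Db := (D / N)%g in fD *.
have okDb : diagram_ok Db by apply: diagram_ok_morph.
have DbG : Db \subset Gb by apply: quotientS.
have DbZ : Db \subset 'N('Z(Gb))%g := subset_trans DbG (normal_norm (center_normal Gb)).
set Dz := (Db / 'Z(Gb))%g in fD.
have okDz : diagram_ok Dz by apply: diagram_ok_morph.
have DzG : Dz \subset (Gb / 'Z(Gb))%g by apply: quotientS.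
have okE : diagram_ok E := reflections_ok Bs.
have EH : E \subset H by apply: subset_gen.
have EZ : E \subset 'N('Z(H))%g := subset_trans EH (normal_norm (center_normal H)).
pose cN := coset N; pose cZ := coset 'Z(Gb)%g; pose cH := coset 'Z(H)%g.
have D_Db t : t \in D -> cN t \in Db.
  by move=> tD; apply: mem_morphim => //; apply: (subsetP DN).
have Db_Dz b : b \in Db -> cZ b \in Dz.
  by move=> bD; apply: mem_morphim => //; apply: (subsetP DbZ).
have adjN s t : s \in D -> t \in D ->
  diagram_adj (cN s) (cN t) = diagram_adj s t && (cN s != cN t).
  exact: diagram_adj_morph.
have adjZ s t : s \in Db -> t \in Db ->
  diagram_adj (cZ s) (cZ t) = diagram_adj s t && (cZ s != cZ t).
  exact: diagram_adj_morph.
have adjH s t : s \in E -> t \in E ->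
  diagram_adj (cH s) (cH t) = diagram_adj s t && (cH s != cH t).
  exact: diagram_adj_morph.
have f_inj := injmP injf.
have adjF s t : s \in Dz -> t \in Dz -> diagram_adj (f s) (f t) = diagram_adj s t.
  move=> sD tD; rewrite (diagram_adj_morph f okDz) // (inj_in_eq f_inj) ?(subsetP DzG) //.
  by case: eqVneq => [->|_]; rewrite ?andbT // andbF /diagram_adj okDz.1 // order1.
have E_neighbor e : e \in E -> exists2 r, r \in E & diagram_adj r e.
  move=> eE; have [qe _] := refl_centerP eE; have [y [qy yx ne1 ne2]] := neighbor _ qe.
  have [r rE rc] := reflection_of_center qy; exists r => //.
  rewrite (reflections_order Bs rE eE).2; apply/andP; split.
    apply: contraNneq ne1 => re; move: rc ne2; rewrite re.
    by case=> ->; rewrite ?eqxx // opprK eqxx.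
  by case: rc => ->; rewrite ?form_valNl ?oppr_eq0.
have cH_inj : {in E &, injective cH}.
  by move=> s t sE tE; have [r rE rs] := E_neighbor s sE; apply: (center_coset_inj okE EH rE).
pose Phi t := f (cZ (cN t)).
have Phi_E t : t \in D -> exists2 e, e \in E & cH e = Phi t.
  move=> tD; have : Phi t \in (E / 'Z(H))%g.
    by rewrite -fD mem_morphim ?(subsetP DzG) ?Db_Dz ?D_Db.
  by case/morphimP => e _ eE ->; exists e.
have E_Phi e : e \in E -> exists2 t, t \in D & Phi t = cH e.
  move=> eE; have : cH e \in (E / 'Z(H))%g.
    by apply: mem_morphim => //; apply: (subsetP EZ).
  rewrite -fD => /morphimP[_ _ /morphimP[_ _ /morphimP[t _ tD ->] ->] ->].
  by exists t.
have adjPhi s t : s \in D -> t \in D -> diagram_adj (Phi s) (Phi t) -> diagram_adj (cN s) (cN t).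
  by move=> sD tD; rewrite adjF ?Db_Dz ?D_Db // adjZ ?D_Db // => /andP[].
(* The neighbour needed in D / N is found among the reflections and pulled back by [E_Phi] and
   [adjPhi]. *)
have Phi_inj s t : s \in D -> t \in D -> Phi s = Phi t -> cN s = cN t.
  move=> sD tD st; have [e eE es] := Phi_E s sD; have [r rE re] := E_neighbor e eE.
  have [u uD ur] := E_Phi r rE.
  apply: (center_coset_inj okDb DbG (D_Db _ uD)); rewrite ?D_Db //.
    apply: adjPhi => //; rewrite ur -es adjH // re (inj_in_eq cH_inj) //=.
    by apply: contraTneq re => ->; rewrite /diagram_adj okE.1 // order1.
  by apply: f_inj st; rewrite (subsetP DzG) ?Db_Dz ?D_Db.
(* The lift to a reflection exists by [Phi_E], so the default value is never taken on [D]. *)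
pose phi t := odflt 1%g [pick e in E | cH e == Phi t].
have phiP t : t \in D -> phi t \in E /\ cH (phi t) = Phi t.
  move=> tD; rewrite /phi; case: pickP => [e /andP[eE /eqP]|no] //=.
  by have [e eE et] := Phi_E t tD; have := no e; rewrite eE et eqxx.
have phi_eq s t : s \in D -> t \in D -> (phi s == phi t) = (cN s == cN t).
  move=> sD tD; have [[sE sP] [tE tP]] := (phiP s sD, phiP t tD).
  apply/eqP/eqP => [st|st]; last by apply: cH_inj => //; rewrite sP tP /Phi st.
  by apply: Phi_inj => //; rewrite -sP -tP st.
have cN_eq s t : s \in D -> t \in D -> (cN s == cN t) = (s * t \in N)%g.
  move=> sD tD; have [sN tN] := (subsetP DN _ sD, subsetP DN _ tD).
  have -> : (cN s == cN t) = (cN (s * t)%g == 1%g).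
    by rewrite /cN morphM // -eq_invg_mul -morphV //= involV ?okD.1.
  by apply/eqP/idP => [|/coset_id //]; apply: coset_idr; rewrite groupM.
pose x t := refl_center B (phi t).
have xP t : t \in D -> q (x t) (x t) = 1.
  by move=> /phiP[tE _]; case: (refl_centerP tE).
have adj_phi s t : s \in D -> t \in D ->
    diagram_adj (phi s) (phi t) = diagram_adj s t && (cN s != cN t).
  move=> sD tD; have [[sE sP] [tE tP]] := (phiP s sD, phiP t tD).
  rewrite -phi_eq //; have [->|ne] := eqVneq (phi s) (phi t).
    by rewrite andbF /diagram_adj okE.1 // order1.
  have := adjH _ _ sE tE; rewrite (inj_in_eq cH_inj) // ne andbT => <-.
  rewrite sP tP adjF ?Db_Dz ?D_Db // adjZ ?D_Db // adjN // -phi_eq // ne !andbT.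
  suff -> : cZ (cN s) != cZ (cN t) by rewrite andbT.
  apply: contraNneq ne => e; apply/eqP; apply: cH_inj => //.
  by rewrite sP tP /Phi e.
exists x; split=> // [s t sD tD|y qy].
  have [[sE sP] [tE tP]] := (phiP s sD, phiP t tD).
  have := (reflections_order Bs sE tE).2; rewrite adj_phi // phi_eq // -/(x s) -/(x t) -/q.
  have [st _|st] := eqVneq (cN s) (cN t).
    (* Within a fibre s t lies in the 3-group [N], so its order is 1 or 3: the fibre is a clique. *)
    have -> : x s = x t.
      by rewrite /x; congr refl_center; apply/eqP; rewrite phi_eq // st.
    rewrite xP // oner_eq0; have := ordDD s t sD tD.
    have := cN_eq s t sD tD; rewrite st eqxx => /esym/(mem_p_elt pN).
    rewrite /p_elt /diagram_adj !inE => p3 /or3P[] /eqP o; rewrite o ?orbT // in p3 *.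
    by rewrite -{1}(involV (okD.1 _ sD)) eq_invg_mul -order_eq1 o.
  by rewrite !andbT /= => <-; case: eqVneq => // e; rewrite e eqxx in st.
(* The elements of D with vector y or - y are those mapped to the reflection e, that is, those in
   the coset of N through t. *)
have [e eE ey] := reflection_of_center qy; have [t tD te] := E_Phi e eE.
have pt : phi t = e by have [tE tP] := phiP t tD; apply: cH_inj => //; rewrite tP.
rewrite -(fibN t tD); apply: eq_card => s; rewrite !inE; case sD: (s \in D) => //=.
have [sE sP] := phiP s sD.
transitivity (phi s == phi t).
  rewrite pt; apply/idP/eqP => [|se]; last first.
    by rewrite /x se; case: ey => ->; rewrite eqxx ?orbT.
  move=> xs; apply: (refl_center_inj sE eE); rewrite -/(x s).
  by case/orP: xs => /eqP->; case: ey => ->; rewrite ?opprK; [left|right|right|left].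
by rewrite phi_eq // eq_sym cN_eq // mem_lcoset involV ?okD.1.
Qed.

(** * The spectrum in coordinates *)

Section Coordinates.
Variables (theta : algC) (theta2 : theta ^+ 2 = - 3).
Variables (m h : nat) (B : 'M['F_3]_m) (Bs : B^T = B) (dB : \det B != 0).
Variables (gT : finGroupType) (D : {set gT}) (x : gT -> 'rV['F_3]_m).
Notation q := (form_val B).
Let s := gauss_sum theta B + gauss_sum (- theta) B.
Let d := theta * (gauss_sum theta B - gauss_sum (- theta) B).

(** The kernel row of y sums to 2 (3^m - d) / 9, and y and - y account for 2 of it; if nothing else
    contributed, 3^m - d would be 9. *)
Lemma sphere_neighbor y : 3 ^+ m - d != 9 -> q y y = 1 ->
  exists z, [/\ q z z = 1, q z y != 0, z != y & z != - y].
Proof.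
move=> md qy; pose nbr z := [&& q z z == 1, q z y != 0, z != y & z != - y].
have [z /and4P[/eqP ? ? ? ?]|no] := pickP nbr; first by exists z.
case/negP: md; rewrite -(inj_eq (mulfI (_ : 2 != 0))) ?pnatr_eq0 //.
rewrite -(inj_eq (mulIf (_ : 9^-1 != 0))) ?invr_eq0 ?pnatr_eq0 //.
rewrite -(form_ker_row theta2 Bs dB qy) mulfK ?pnatr_eq0 //.
have yNy : y != - y.
  rewrite -addr_eq0 -mulr2n -scaler_nat scaler_eq0 negb_or /=.
  by apply: contra_eqN qy => /eqP->; rewrite form_val0l eq_sym.
rewrite (bigD1 y) ?qy //= (bigD1 (- y)) /=; last first.
  by rewrite form_valNl form_valNr opprK qy eqxx eq_sym.
rewrite big1 => [|z /andP[/andP[qz zy] zNy]]; last first.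
  rewrite /form_ker; have := no z; rewrite /nbr qz zy zNy !andbT /= => /negbFE.
  by rewrite (form_valC Bs) => ->.
by rewrite /form_ker form_valNr qy oppr_eq0 oner_eq0 addr0 -natrD.
Qed.

Hypothesis xP : forall t, t \in D -> q (x t) (x t) = 1.
Hypothesis adjP : forall s t, s \in D -> t \in D ->
  (s == t) || diagram_adj s t = (q (x s) (x t) != 0).
Hypothesis fibP : forall y, q y y = 1 ->
  #|[set s in D | (x s == y) || (x s == - y)]| = (3 ^ h)%N.

(** Double counting of the pairs (t, y) with y equal to plus or minus [x t]: each t occurs in two of
    them, each unit vector y in 3^h. *)
Lemma sum_coordinates (g : 'rV['F_3]_m -> algC) : (forall y, g (- y) = g y) ->
  \sum_(t in D) g (x t) = 3 ^+ h * (\sum_(y | q y y == 1) g y) / 2.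
Proof.
move=> gN; apply: canRL (mulfK _) _; first by rewrite pnatr_eq0.
transitivity (\sum_(t in D) \sum_(y | (q y y == 1) && ((x t == y) || (x t == - y))) g (x t)).
  rewrite mulr_suml; apply: eq_bigr => t tD; rewrite sumr_const.
  have qx := xP tD.
  have xNx : x t != - x t.
    rewrite -addr_eq0 -mulr2n -scaler_nat scaler_eq0 negb_or /=.
    by apply: contra_eqN qx => /eqP->; rewrite form_val0l eq_sym.
  rewrite (@eq_card _ _ (mem [set x t; - x t])) ?cards2 ?xNx ?mulr_natr // => y.
  rewrite !inE; apply/andP/orP => [[_ /orP[] /eqP->]|[] /eqP->].
  - by left.
  - by right; rewrite opprK.
  - by rewrite qx !eqxx.
  - by rewrite form_valNl form_valNr !opprK qx !eqxx orbT.
rewrite (exchange_big_dep (fun y => q y y == 1)) => [|t y _ /andP[]] //=.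
rewrite mulr_sumr; apply: eq_bigr => y /eqP qy.
rewrite -natrX -(fibP qy) -sum1_card natr_sum mulr_suml.
apply: eq_big => [t|t]; first by rewrite !inE qy eqxx.
by rewrite mul1r => /andP[_ /andP[_ /orP[]/eqP->]]; rewrite ?gN.
Qed.

Let P : 'M[algC]_#|D| := \matrix_(i, j) form_ker B (x (enum_val i)) (x (enum_val j)).

Lemma form_kerC y z : form_ker B y z = form_ker B z y.
Proof. by rewrite /form_ker (form_valC Bs). Qed.
Lemma form_kerN y z : form_ker B y (- z) = form_ker B y z.
Proof. by rewrite /form_ker form_valNr oppr_eq0. Qed.

Lemma diagram_card : #|D|%:R = 3 ^+ h * (2 * 3 ^+ m - s - d) / 12.
Proof.
rewrite -sum1_card natr_sum (sum_coordinates (g := fun=> 1)) //.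
by rewrite (sphere_card theta2 Bs dB) -/s -/d; field.
Qed.

Let k := 3 ^+ h * (3 ^+ m - d) / 9.

Lemma diagram_row y : q y y = 1 -> \sum_(t in D) form_ker B y (x t) = k.
Proof.
move=> qy; rewrite (@sum_coordinates (form_ker B y)); last exact: form_kerN.
by rewrite (form_ker_row theta2) // -/d /k; field.
Qed.

Lemma diagram_sqr y z : q y y = 1 -> q z z = 1 ->
  \sum_(t in D) form_ker B y (x t) * form_ker B (x t) z =
  3 ^+ h * (2 * 3 ^+ m + 3 * s - 3 * d - 3 * s * form_ker B y z
       + ((y == z) || (y == - z))%:R * 3 ^+ m) / 27.
Proof.
move=> qy qz; rewrite (@sum_coordinates (fun t => form_ker B y t * form_ker B t z)).
  by rewrite (form_ker_sqr theta2) // -/s -/d; field.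
by move=> t; rewrite form_kerN (form_kerC (- t)) form_kerN (form_kerC z).
Qed.

(** Elements of one fibre have equal rows in P. In P^3 this handles the term of P^2 supported on the
    fibres. *)
Lemma diagram_fibre y z : q y y = 1 ->
  \sum_(t in D) ((x t == y) || (x t == - y))%:R * form_ker B (x t) z =
  3 ^+ h * form_ker B y z.
Proof.
move=> qy; rewrite -natrX -(fibP qy) -sum1_card natr_sum mulr_suml big_mkcond.
rewrite [RHS]big_mkcond; apply: eq_bigr => t _; rewrite inE.
case: (t \in D) => //=; case: orP => [|_]; last by rewrite mul0r.
by rewrite !mul1r => -[] /eqP-> //; rewrite form_kerC form_kerN form_kerC.
Qed.

Hypothesis D_inv : forall t, t \in D -> ~~ diagram_adj t t.
Hypothesis D_gt0 : (0 < #|D|)%N.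

Lemma form_ker_adj i j : i \in D -> j \in D ->
  form_ker B (x i) (x j) = (diagram_adj i j)%:R + (i == j)%:R.
Proof.
move=> iD jD; rewrite /form_ker -adjP //.
by case: eqVneq => [->|_] /=; rewrite ?addr0 // (negPf (D_inv jD)) add0r.
Qed.

(** By [diagram_sqr], P^2 is a combination of J, P and the fibre matrix F, and F P = 3^h P, J P = K
    J. Multiplying by P gives the cubic relation of [three_eigenvalues]; the conditions on a + b and
    a b match its coefficients. *)
Lemma coordinates_spectrum (a b : algC) :
    let K := k in
    a + b = - (3 ^+ h * s / 9) -> a * b = - (3 ^+ h * 3 ^+ h * 3 ^+ m / 27) ->
    uniq [:: 0; a; b; K] ->
  exists f g : nat,
    [/\ f%:R = (#|D|%:R - K) * (K - b) / (a * (a - b)),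
        g%:R = (#|D|%:R - K) * (K - a) / (b * (b - a)) &
        diagram_spectrum D (K - 1) [:: (a - 1, f); (b - 1, g)] (- 1)].
Proof.
move=> K eD eM abK.
have diagE : diagram_mx D = P - 1%:M.
  apply/matrixP => i j; rewrite !mxE form_ker_adj ?enum_valP //.
  by rewrite (inj_eq enum_val_inj) addrK.
have qE i : q (x (enum_val i)) (x (enum_val i)) = 1 := xP (enum_valP i).
have PC i j : P i j = P j i by rewrite !mxE form_kerC.
have sumE (F : gT -> algC) : \sum_(i < #|D|) F (enum_val i) = \sum_(t in D) F t.
  by rewrite [RHS]big_enum_val.
have rowP i : \sum_j P i j = K.
  under eq_bigr do rewrite mxE.
  by rewrite (sumE (fun t => form_ker B (x (enum_val i)) (x t))) diagram_row.
(* The coefficient of J in P^2, times K because J P = K J. *)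
pose c := 3 ^+ h * (2 * 3 ^+ m + 3 * s - 3 * d) / 27 * K.
have P2 i j : (P *m P) i j = 3 ^+ h * (2 * 3 ^+ m + 3 * s - 3 * d - 3 * s * P i j
   + ((x (enum_val i) == x (enum_val j)) || (x (enum_val i) == - x (enum_val j)))%:R * 3 ^+ m) / 27.
  rewrite !mxE; under eq_bigr do rewrite !mxE.
  rewrite (sumE (fun t => form_ker B (x (enum_val i)) (x t) * form_ker B (x t) (x (enum_val j)))).
  by rewrite diagram_sqr.
have P3 i j : (P *m P *m P) i j = (a + b) * (P *m P) i j - a * b * P i j + c.
  rewrite [LHS]mxE.
  transitivity (\sum_l 3 ^+ h / 27 * ((2 * 3 ^+ m + 3 * s - 3 * d) * P j l
      - 3 * s * (P i l * P l j) + 3 ^+ m * (((x (enum_val l) == x (enum_val i))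
        || (x (enum_val l) == - x (enum_val i)))%:R * P l j))).
    apply: eq_bigr => l _; rewrite P2 (PC j l) (eq_sym (x (enum_val l))).
    have -> : (x (enum_val i) == - x (enum_val l)) = (x (enum_val l) == - x (enum_val i)).
      by rewrite -eqr_oppLR eq_sym.
    by field.
  rewrite -mulr_sumr !big_split /= sumrN -!mulr_sumr rowP.
  have -> : \sum_l P i l * P l j = (P *m P) i j by rewrite mxE.
  have -> : \sum_l ((x (enum_val l) == x (enum_val i))
      || (x (enum_val l) == - x (enum_val i)))%:R * P l j = 3 ^+ h * P i j.
    under eq_bigr do rewrite mxE.
    rewrite (sumE (fun t => ((x t == x (enum_val i)) || (x t == - x (enum_val i)))%:R
      * form_ker B (x t) (x (enum_val j)))).
    by rewrite diagram_fibre // mxE.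
  by rewrite /c eD eM; field.
have [||f [g [z [charP tr1 tr2]]]] := @three_eigenvalues _ P K a b c D_gt0 abK.
- apply/matrixP => i j; rewrite !mxE mulr1 -[RHS](rowP j).
  by apply: eq_bigr => l _; rewrite PC mxE mul1r.
- apply/matrixP => i j.
  have addE (X Y : 'M[algC]_#|D|) : (X + Y) i j = X i j + Y i j by rewrite mxE.
  have oppE (X : 'M[algC]_#|D|) : (- X) i j = - X i j by rewrite mxE.
  have mulE e (X : 'M[algC]_#|D|) : (e *: X) i j = e * X i j by rewrite mxE.
  by rewrite !(addE, oppE, mulE) P3 [const_mx 1 i j]mxE; ring.
have n1 : \tr P = #|D|%:R.
  rewrite /mxtrace; under eq_bigr do rewrite mxE /form_ker qE oner_eq0.
  by rewrite sumr_const card_ord.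
(* P is symmetric with entries 0 and 1, so the trace of its square is the sum of its entries. *)
have n2 : \tr (P *m P) = #|D|%:R * K.
  rewrite /mxtrace mulr_natl -[in RHS](card_ord #|D|) -sumr_const; apply: eq_bigr => i _.
  rewrite -(rowP i) mxE; apply: eq_bigr => j _; rewrite PC !mxE /form_ker.
  by rewrite -natrM mulnb andbb.
have [a0 b0 ab] : [/\ a != 0, b != 0 & a - b != 0].
  move: abK; rewrite /= !inE !negb_or subr_eq0 !(eq_sym 0).
  by case/and4P=> /and3P[-> -> _] /andP[-> _].
rewrite n1 -(mulr_natr a) -(mulr_natr b) in tr1.
rewrite n2 -(mulr_natr (a ^+ 2)) -(mulr_natr (b ^+ 2)) in tr2.
exists f, g; split.
(* Subtracting b times the equation for tr P from that for tr P^2 eliminates g. *)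
- apply: canRL (mulfK _) _; first by rewrite mulf_neq0.
  have -> : (#|D|%:R - K) * (K - b) = (#|D|%:R * K - K ^+ 2) - b * (#|D|%:R - K) by ring.
  by rewrite tr2 tr1; ring.
- apply: canRL (mulfK _) _; first by rewrite mulf_neq0 // -opprB oppr_eq0.
  have -> : (#|D|%:R - K) * (K - a) = (#|D|%:R * K - K ^+ 2) - a * (#|D|%:R - K) by ring.
  by rewrite tr2 tr1; ring.
split.
  move=> t tD; rewrite /diagram_degree -sum1_card natr_sum /K -(diagram_row (xP tD)).
  (* The degree is K - 1: the row of P also counts t itself. *)
  rewrite [X in _ = X - 1](eq_bigr (fun r => (diagram_adj t r)%:R + (t == r)%:R));
    last by move=> r rD; rewrite form_ker_adj.
  rewrite big_split /= [X in _ + X - 1](bigD1 t) //= eqxx [X in 1 + X]big1 => [|r /andP[_]].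
    rewrite addr0 addrK big_mkcond [RHS]big_mkcond; apply: eq_bigr => r _.
    by rewrite inE; case: (r \in D) => //=; case: (diagram_adj t r).
  by rewrite eq_sym => /negPf->.
by exists z; rewrite diagE charP !big_cons big_nil mulr1 polyCN opprK polyC1 !mulrA.
Qed.
End Coordinates.

(** * Evaluation in odd and in even dimension *)

Lemma F3_signN1 n : F3_sign ((-1) ^+ n) = (-1) ^+ n.
Proof. by elim: n => [|n IH] //; rewrite !exprS F3_signM IH. Qed.

Lemma F3_sign_det (m : nat) (B : 'M['F_3]_m) (eps : int) : eps = 1 \/ eps = -1 ->
  form_of_sign B eps -> F3_sign (\det B) = eps%:~R * (-1) ^+ 'C(m.+1, 2).
Proof.
move=> eps1 [_ _ dB]; rewrite -F3_signN1 -dB F3_signM.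
by case: eps1 => ->; rewrite /= ?mulr1 ?mul1r // [F3_sign (-1)]/= mulrC -mulrA mulrNN !mulr1.
Qed.

(** The binomial coefficient is (j + 2)(2 j + 3), which has the parity of j. *)
Lemma sign_bin2_odd j : (-1) ^+ 'C((2 * j + 3).+1, 2) = (-1) ^+ j :> algC.
Proof.
rewrite bin2 (_ : _./2 = ((j + 2) * (2 * j + 3))%N); last first.
  rewrite (_ : (_ * _ = ((j + 2) * (2 * j + 3)).*2)%N) ?doubleK //.
  by rewrite -muln2; lia.
by rewrite -signr_odd !(oddM, oddD) /= !addbF andbT signr_odd.
Qed.

Lemma sign_bin2_even j : (-1) ^+ 'C((2 * j + 4).+1, 2) = (-1) ^+ j :> algC.
Proof.
rewrite bin2 (_ : _./2 = ((j + 2) * (2 * j + 5))%N); last first.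
  rewrite (_ : (_ * _ = ((j + 2) * (2 * j + 5)).*2)%N) ?doubleK //.
  by rewrite -muln2; lia.
by rewrite -signr_odd !(oddM, oddD) /= !addbF andbT signr_odd.
Qed.

(** The candidate eigenvalues are integer multiples of 3^h 3^j, so their distinctness is decided in
    the integers. *)
Lemma uniq_scaled_int (c : algC) (zs : seq int) :
  c != 0 -> uniq zs -> uniq [seq c * z%:~R | z <- zs].
Proof. by move=> c0; rewrite map_inj_uniq // => z1 z2 /(mulfI c0)/intr_inj. Qed.

Theorem proposition6p19 (eps : int) (h m : nat) (gT : finGroupType)
    (G : {group gT}) (D : {set gT})
    (eps_sign : eps = 1 \/ eps = -1)
    (GD : three_transposition G D)
    (GD_type : has_type_3_plusOmega G D h m eps) :
  let e : algC := eps%:~R in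
  ((5 <= m)%N -> odd m ->
     #|D|%:R = 3 ^+ h * (3 ^+ (m - 1) - e * 3 ^+ ((m - 1) %/ 2)) / 2 :> algC
     /\ exists f g : nat,
       [/\ f%:R = (3 ^+ (m - 1) - 1 - (e - 1) * (3 ^+ ((m - 1) %/ 2) - 1)) / 4
             :> algC,
           g%:R = (3 ^+ (m - 1) - 1 - (e + 1) * (3 ^+ ((m - 1) %/ 2) + 1)) / 4
             :> algC
         & diagram_spectrum D
             (3 ^+ (m - 2 + h) - 2 * e * 3 ^+ ((m - 3) %/ 2 + h) - 1)
             [:: (3 ^+ ((m - 3) %/ 2 + h) - 1, f);
                 (- 3 ^+ ((m - 3) %/ 2 + h) - 1, g)]
             (-1)])
  /\
  ((6 <= m)%N -> ~~ odd m ->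
     #|D|%:R = 3 ^+ h * (3 ^+ (m - 1) - e * 3 ^+ ((m - 2) %/ 2)) / 2 :> algC
     /\ exists d e' : nat,
       [/\ d%:R = (3 ^+ (m %/ 2) - e) * (3 ^+ ((m - 2) %/ 2) - e) / 8 :> algC,
           e'%:R = (3 ^+ m - 9) / 8 :> algC
         & diagram_spectrum D
             (3 ^+ (m - 2 + h) - 1)
             [:: (- e * 3 ^+ ((m - 2) %/ 2 + h) - 1, d);
                 (e * 3 ^+ ((m - 4) %/ 2 + h) - 1, e')]
             (-1)]).
Proof.
move=> e; have [N [B [nNG pN fibN signB typeB]]] := GD_type.
have [Bs dB _] := signB; have detB := F3_sign_det eps_sign signB.
have [/imsetP[t0 t0G D_class] _ ordD _] := GD.
have D_gt0 : (0 < #|D|)%N by apply/card_gt0P; exists t0; rewrite D_class class_refl.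
have D_inv t : t \in D -> ~~ diagram_adj t t.
  move=> tD; rewrite /diagram_adj (_ : (t * t = 1)%g) ?order1 //.
  by apply/eqP; rewrite -expg2 -order_dvdn ordD.
pose theta : algC := sqrtC (- 3); have theta2 : theta ^+ 2 = - 3 := sqrtCK _.
have thetaN2 : (- theta) ^+ 2 = - 3 by rewrite sqrrN.
pose s := gauss_sum theta B + gauss_sum (- theta) B.
pose d := theta * (gauss_sum theta B - gauss_sum (- theta) B).
(* The inequality is the condition of [sphere_neighbor]; it is checked separately for each
   parity. *)
have coords : 3 ^+ m - d != 9 ->
    #|D|%:R = 3 ^+ h * (2 * 3 ^+ m - s - d) / 12 /\
    let K := 3 ^+ h * (3 ^+ m - d) / 9 in
    forall a b : algC, a + b = - (3 ^+ h * s / 9) ->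
      a * b = - (3 ^+ h * 3 ^+ h * 3 ^+ m / 27) -> uniq [:: 0; a; b; K] ->
    exists f g : nat,
    [/\ f%:R = (#|D|%:R - K) * (K - b) / (a * (a - b)),
        g%:R = (#|D|%:R - K) * (K - a) / (b * (b - a)) &
        diagram_spectrum D (K - 1) [:: (a - 1, f); (b - 1, g)] (- 1)].
  move=> md; have nb y := sphere_neighbor theta2 Bs dB (y := y) md.
  have [x [xP adjP fibP]] := plusOmega_coordinates GD nNG pN fibN Bs typeB nb.
  split; first exact: diagram_card xP fibP.
  by move=> K a b; apply: coordinates_spectrum xP adjP fibP D_inv D_gt0 _ _.
have [H0 Q0 Qint] : [/\ 3 ^+ h != 0 :> algC, forall j, 3 ^+ j != 0 :> algC
    & forall j, (0 < j)%N -> exists2 z : int, 3 ^+ j = z%:~R :> algC & 3 <= z].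
  split=> [|j|j j_gt0]; rewrite ?expf_neq0 ?pnatr_eq0 //.
  exists ((3 ^ j)%N : int); first by rewrite -natrX.
  by have := leq_pexp2l (isT : (0 < 3)%N) j_gt0; lia.
split=> m_ge m_par.
- have [j mE j_gt0] : exists2 j, m = (2 * j + 3)%N & (0 < j)%N.
    by exists ((m - 3) %/ 2)%N; lia.
  have -> : (m - 1 = 2 * j + 2)%N by lia.
  have -> : ((m - 3) %/ 2 + h = j + h)%N by lia.
  have -> : ((2 * j + 2) %/ 2 = j + 1)%N by lia.
  have -> : (m - 2 + h = 2 * j + 1 + h)%N by lia.
  have Cm : (-1) ^+ 'C(m.+1, 2) = (-1) ^+ j :> algC by rewrite mE sign_bin2_odd.
  have [Q3 [z Qz z3]] := (Q0 j, Qint j j_gt0).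
  (* With m = 2 j + 3, the power is (-3)^j (-3 theta). *)
  have thm : theta ^+ m = - ((-1) ^+ j * 3 * 3 ^+ j * theta).
    by rewrite mE exprD exprM theta2 -[- 3]mulN1r exprMn exprS theta2; ring.
  have thNm : (- theta) ^+ m = - theta ^+ m.
    by rewrite exprNn -signr_odd m_par mulN1r.
  have sj : (-1) ^+ j * (-1) ^+ j = 1 :> algC by rewrite -expr2 sqrr_sign.
  have sE : s = 0 by rewrite /s !gauss_sumE // thNm mulrN subrr.
  have dE : d = 18 * e * 3 ^+ j.
    rewrite /d !gauss_sumE // thNm thm detB Cm -/e.
    by move: theta2; rewrite expr2 => tt; ring: sj tt.
  have mQ : 3 ^+ m = 27 * 3 ^+ j ^+ 2 :> algC by rewrite mE exprD mulnC exprM; ring.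
  move: coords; rewrite sE dE mQ (exprD 3 (2 * j + 1) h) (exprD 3 (2 * j) 1).
  rewrite (exprD 3 (2 * j) 2) (exprD 3 j h) (exprD 3 j 1) mulnC exprM.
  move: (3 ^+ j) Qz Q3 => Q Qz Q3.
  move: (3 ^+ h) H0 => H H0 coords; have wE : (3 * z - 2 * eps)%:~R = 3 * Q - 2 * e.
    by rewrite rmorphB !rmorphM /= -Qz.
  have [|n_card spec] := coords.
    (* Dividing 3^m - d = 9 by 9 gives Q (3 Q - 2 e) = 1, impossible for an integer Q >= 3. *)
    apply/eqP => eq9; suff : z * (3 * z - 2 * eps) = 1 by case: eps_sign => ->; nia.
    apply: (@intr_inj algC); rewrite rmorphM /= wE -Qz.
    transitivity ((27 * Q ^+ 2 - 18 * e * Q) / 9); first by field.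
    by rewrite eq9; field.
  have ab0 : H * Q - - (H * Q) != 0 by rewrite opprK -mulr2n mulrn_eq0 mulf_neq0.
  have ba0 : - (H * Q) - H * Q != 0 by rewrite -opprB oppr_eq0.
  split; first by rewrite n_card; field.
  (* Here s = 0, so a and b are opposite, with product - (H Q)^2. *)
  have [|||f [g [fE gE fg]]] := spec (H * Q) (- (H * Q)).
  - by field.
  - by field.
  - have := @uniq_scaled_int (H * Q) [:: 0; 1; -1; 3 * z - 2 * eps] (mulf_neq0 H0 Q3).
    rewrite /= wE mulr0 mulr1 mulrN1 (_ : H * _ / 9 = H * Q * (3 * Q - 2 * e)); last by field.
    by apply; rewrite !inE; case: eps_sign => ->; lia.
  exists f, g; split.
  - by rewrite fE n_card; case: eps_sign => e1; rewrite /e e1; field; rewrite ?ab0 ?ba0 Q3.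
  - by rewrite gE n_card; case: eps_sign => e1; rewrite /e e1; field; rewrite ?ab0 ?ba0 Q3.
  move: fg; congr (diagram_spectrum _ _ [:: (_, _); (_, _)] _); by field.
have [j mE j_gt0] : exists2 j, m = (2 * j + 4)%N & (0 < j)%N.
  by exists ((m - 4) %/ 2)%N; lia.
have -> : (m - 1 = 2 * j + 3)%N by lia.
have -> : ((m - 2) %/ 2 = j + 1)%N by lia.
have -> : ((m - 4) %/ 2 = j)%N by lia.
have -> : (m %/ 2 = j + 2)%N by lia.
have -> : (m - 2 + h = 2 * j + 2 + h)%N by lia.
have Cm : (-1) ^+ 'C(m.+1, 2) = (-1) ^+ j :> algC by rewrite mE sign_bin2_even.
have [Q3 [z Qz z3]] := (Q0 j, Qint j j_gt0).
have thm : theta ^+ m = (-1) ^+ j * 9 * 3 ^+ j.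
  by rewrite mE exprD exprM theta2 -[- 3]mulN1r exprMn (exprM theta 2 2) theta2; ring.
have thNm : (- theta) ^+ m = theta ^+ m.
  by rewrite exprNn -signr_odd (negPf m_par) mul1r.
have sj : (-1) ^+ j * (-1) ^+ j = 1 :> algC by rewrite -expr2 sqrr_sign.
have dE : d = 0 by rewrite /d !gauss_sumE // thNm subrr mulr0.
have sE : s = 18 * e * 3 ^+ j.
  by rewrite /s !gauss_sumE // thNm thm detB Cm -/e; ring: sj.
have mQ : 3 ^+ m = 81 * 3 ^+ j ^+ 2 :> algC by rewrite mE exprD mulnC exprM; ring.
move: coords; rewrite sE dE mQ (exprD 3 (2 * j + 2) h) (exprD 3 (2 * j) 2).
rewrite (exprD 3 (2 * j) 3) (exprD 3 (j + 1) h) (exprD 3 j h) (exprD 3 j 1) (exprD 3 j 2).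
rewrite mulnC exprM; move: (3 ^+ j) Qz Q3 => Q Qz Q3.
move: (3 ^+ h) H0 => H H0 coords; have wE : (9 * z)%:~R = 9 * Q.
  by rewrite rmorphM /= -Qz.
have [|n_card spec] := coords.
  apply/eqP => eq9; suff : 9 * (z * z) = 1 by nia.
  apply: (@intr_inj algC); rewrite !rmorphM /= -Qz.
  transitivity ((81 * Q ^+ 2 - 0) / 9); first by field.
  by rewrite eq9; field.
split; first by rewrite n_card; field.
(* Here a + b = - 2 e H Q and a b = - 3 (H Q)^2, using e^2 = 1. *)
have [|||f [g [fE gE fg]]] := spec (- e * 3 * (H * Q)) (e * (H * Q)).
- by field.
- by case: eps_sign => e1; rewrite /e e1; field.
- have := @uniq_scaled_int (H * Q) [:: 0; - eps * 3; eps; 9 * z] (mulf_neq0 H0 Q3).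
  rewrite /= wE mulr0 rmorphM rmorphN /= -/e !(mulrC (H * Q)).
  rewrite (_ : H * _ / 9 = 9 * Q * (H * Q)); last by field.
  by apply; rewrite !inE; case: eps_sign => ->; lia.
(* The difference a - b is 4 H Q up to sign, a denominator in both multiplicities. *)
have c4 (c : algC) : c = 4 * (H * Q) \/ c = - (4 * (H * Q)) -> c != 0.
  by case=> ->; rewrite ?oppr_eq0 !mulf_neq0 ?pnatr_eq0.
exists f, g; split.
- rewrite fE n_card; case: eps_sign => e1; rewrite /e e1; field;
    by rewrite Q3 H0 !andbT; apply: c4; (left; ring) || (right; ring).
- rewrite gE n_card; case: eps_sign => e1; rewrite /e e1; field;
    by rewrite Q3 H0 !andbT; apply: c4; (left; ring) || (right; ring).
by move: fg; congr (diagram_spectrum _ _ [:: (_, _); (_, _)] _); field.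
Qed.
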